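(* Let $H$ be a real Hilbert space with scalar product $(\cdot,\cdot)$ and norm $\|\cdot\|$, and let $\mathcal{D}\subset H$ be a Banach space continuously embedded in $H$. For every $k\in\mathbb{R}$ let $L(k)$ be a self-adjoint (possibly unbounded) operator on $H$ with domain $\mathcal{D}$ (independent of $k$), and let $A(k)\in\mathcal{L}(\mathcal{D},H)$. Assume that $k\mapsto L(k)\in\mathcal{L}(\mathcal{D},H)$ and $k\mapsto A(k)\in \mathcal{L}(\mathcal{D},H)$ are of class $\mathcal{C}^1$, and denote by $L'(k)\in\mathcal{L}(\mathcal{D},H)$ the derivative of $L$ with respect to $k$. Assume moreover: 1. There exist $K>0$ and $\alpha>0$ such that $L(k)\ge \alpha\,\mathrm{Id}$ for all $|k|\ge K$. 2. For every $k\neq 0$ there is $c_k>0$ such that the essential spectrum of $L(k)$ is included in $[c_k,+\infty)$. 3. For every $k_1\ge k_2\ge 0$ one has $L(k_1)\ge L(k_2)$. In addition, if for some $k>0$ and some $U\in\mathcal{D}$, $U\neq 0$, one has $L(k)U=0$, then $(L'(k)U,U)>0$. 4. The spectrum of $L(0)$ is of the form $\{-\lambda\}\cup I$, where $-\lambda<0$ is an isolated simple eigenvalue of $L(0)$ and $I\subset[0,+\infty)$. Then there exist $\sigma>0$, $k\neq 0$ and $U\in\mathcal{D}\setminus\{0\}$ such that $$\sigma A(k)U=L(k)U.$$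
   Context: $\mathcal{L}(\mathcal{D},H)$ denotes the space of bounded linear operators from $\mathcal{D}$ to $H$. For symmetric operators $S,T$ with domain $\mathcal{D}$, $S\ge T$ means $(SU,U)\ge (TU,U)$ for all $U\in\mathcal{D}$. No symmetry or invertibility assumption is made on $A(k)$. In assumption 4, $0$ may belong to the essential spectrum of $L(0)$. *)

(* Defs.v *)
From HB Require Import structures.
From mathcomp Require Import all_boot all_order all_algebra.
From mathcomp Require Import all_classical all_reals all_analysis.

Set Implicit Arguments.
Unset Strict Implicit.
Unset Printing Implicit Defensive.

Import Order.TTheory GRing.Theory Num.Theory.
Import numFieldNormedType.Exports.

Local Open Scope classical_set_scope.
Local Open Scope ring_scope.

Section BoundedOperators.
Variables (R : realType) (V W : normedModType R).

Definition bounded_op_pred : {pred V -> W} :=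
  mem [set f : V -> W | linear f /\ continuous f].

Record bounded_op := BoundedOp {
  bounded_op_fun :> V -> W;
  bounded_op_subproof : bounded_op_fun \in bounded_op_pred }.

HB.instance Definition _ := [isSub for bounded_op_fun].
HB.instance Definition _ := gen_eqMixin bounded_op.
HB.instance Definition _ := gen_choiceMixin bounded_op.

Lemma bounded_opP (f : V -> W) :
  reflect (linear f /\ continuous f) (f \in bounded_op_pred).
Proof. by apply: (iffP idP); rewrite /bounded_op_pred !inE. Qed.

Lemma bounded_op_submod_closed : submod_closed bounded_op_pred.
Proof.
split=> [|a f g /bounded_opP [lf cf] /bounded_opP [lg cg]].
  apply/bounded_opP; split=> [a u v|x]; last exact: cvg_cst.
  by rewrite scaler0 addr0.
apply/bounded_opP; split=> [b u v|x].
  rewrite !fctE lf lg !scalerDr !scalerA (mulrC a b).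
  by rewrite addrACA.
by apply: cvgD; [apply: cvgZr; exact: cf|exact: cg].
Qed.

HB.instance Definition _ :=
  GRing.isSubmodClosed.Build R (V -> W) bounded_op_pred bounded_op_submod_closed.
HB.instance Definition _ := [SubChoice_isSubLmodule of bounded_op by <:].

Lemma bounded_op_linear (T : bounded_op) : linear T.
Proof. by have /bounded_opP[] := bounded_op_subproof T. Qed.

HB.instance Definition _ (T : bounded_op) :=
  GRing.isLinear.Build R V W _ T (bounded_op_linear T).

Lemma bounded_op_continuous (T : bounded_op) : continuous T.
Proof. by have /bounded_opP[] := bounded_op_subproof T. Qed.

Lemma bounded_opD (S T : bounded_op) u : (S + T) u = S u + T u.
Proof. by []. Qed.

Lemma bounded_opB (S T : bounded_op) u : (S - T) u = S u - T u.
Proof. by []. Qed.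

Lemma bounded_opZ a (T : bounded_op) u : (a *: T) u = a *: T u.
Proof. by []. Qed.

Definition op_norm (T : bounded_op) : R :=
  sup [set `|T u| | u in [set u | `|u| <= 1]].

Lemma op_norm_has_sup (T : bounded_op) :
  has_sup [set `|T u| | u in [set u | `|u| <= 1]].
Proof.
split; first by exists `|T 0|, 0 => //=; rewrite normr0.
have /linear_boundedP : bounded_near T (nbhs 0).
  exact/linear_bounded_continuous/bounded_op_continuous.
move=> [M [_ TM]]; exists (`|M| + 1) => _ [u /= u1 <-].
have M1 : 0 <= `|M| + 1 by rewrite addr_ge0.
rewrite (le_trans (TM (`|M| + 1) _ u))//; last by rewrite ler_piMr.
by rewrite (le_lt_trans (ler_norm M))// ltrDl.
Qed.

Lemma op_norm_ub (T : bounded_op) u : `|u| <= 1 -> `|T u| <= op_norm T.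
Proof.
by move=> u1; apply: sup_upper_bound (op_norm_has_sup T) _ _; exists u.
Qed.

Lemma op_norm_le (T : bounded_op) M :
  (forall u, `|u| <= 1 -> `|T u| <= M) -> op_norm T <= M.
Proof.
move=> TM; apply: ge_sup; first by case: (op_norm_has_sup T).
by move=> _ [u /= u1 <-]; exact: TM.
Qed.

Lemma op_norm_ge0 (T : bounded_op) : 0 <= op_norm T.
Proof. by rewrite (le_trans _ (@op_norm_ub T 0 _)) ?normr0. Qed.

Lemma ler_op_normD (S T : bounded_op) : op_norm (S + T) <= op_norm S + op_norm T.
Proof.
apply: op_norm_le => u u1; rewrite bounded_opD (le_trans (ler_normD _ _))//.
by rewrite lerD ?op_norm_ub.
Qed.

Lemma op_normZ a (T : bounded_op) : op_norm (a *: T) = `|a| * op_norm T.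
Proof.
have leZ b (S : bounded_op) : op_norm (b *: S) <= `|b| * op_norm S.
  apply: op_norm_le => u u1.
  by rewrite bounded_opZ normrZ ler_wpM2l ?op_norm_ub.
apply/eqP; rewrite eq_le leZ/=; have [->|a0] := eqVneq a 0.
  by rewrite normr0 mul0r op_norm_ge0.
rewrite -ler_pdivlMl ?normr_gt0// -normfV (le_trans _ (leZ _ _))//.
by rewrite scalerA mulVf// scale1r.
Qed.

Lemma op_norm0_eq0 (T : bounded_op) : op_norm T = 0 -> T = 0.
Proof.
move=> T0; apply/val_inj/funext => u /=.
have [->|u0] := eqVneq u 0; first exact: linear0.
have : `|T (`|u|^-1 *: u)| <= 0.
  by rewrite -T0 op_norm_ub// normrZ normfV normr_id mulVf// normr_eq0.
rewrite linearZ normr_le0 scaler_eq0 invr_eq0 normr_eq0 (negbTE u0)/=.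
by move/eqP.
Qed.

HB.instance Definition _ := @Lmodule_isNormed.Build R bounded_op op_norm
  ler_op_normD op_normZ op_norm0_eq0.

End BoundedOperators.

Section UnboundedOperators.
Variables (R : realType) (H : completeNormedModType R).
Variable dot : {dot H for idfun}.
Variable D : completeNormedModType R.

(* The inclusion of [D] into [H] is an injective [iota : bounded_op D H].  An
   operator on [H] with domain [D] is then an element [T : bounded_op D H], and
   [iota] itself is the restriction of the identity to [D]. *)
Variable iota : bounded_op D H.

(* The second clause says that the graph of the adjoint is the graph of [T]. *)
Definition self_adjoint (T : bounded_op D H) :=
  dense (range iota) /\
  forall v w : H, (forall u, dot (T u) v = dot (iota u) w) <->
    exists u, v = iota u /\ w = T u.

Definition op_ge (S T : bounded_op D H) :=
  forall u, dot (T u) (iota u) <= dot (S u) (iota u).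

(* [H] is a real space, so only real [mu] are considered; the spectrum of the
   complexification of a self-adjoint operator is real and consists of the same
   points. *)
Definition resolvent_set (T : bounded_op D H) : set R :=
  [set mu | exists S : H -> D, [/\ cancel (T - mu *: iota) S,
    cancel S (T - mu *: iota) & continuous (iota \o S)]].

Definition spectrum (T : bounded_op D H) : set R := ~` resolvent_set T.

Definition ker (T : bounded_op D H) : set D := [set u | T u = 0].

Definition lin_span (V : lmodType R) n (e : 'I_n -> V) : set V :=
  [set \sum_(i < n) a i *: e i | a in [set: 'I_n -> R]].

Definition finite_dim (V : lmodType R) (A : set V) :=
  exists n (e : 'I_n -> V), A `<=` lin_span e.

Definition finite_codim (V : lmodType R) (A : set V) :=
  exists n (e : 'I_n -> V),
    forall v, exists a b, [/\ A a, lin_span e b & v = a + b].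

(* For a self-adjoint [T] the following essential spectrum is the spectrum
   deprived of the isolated eigenvalues of finite multiplicity. *)
Definition fredholm (T : bounded_op D H) :=
  [/\ finite_dim (ker T), closed (range T) & finite_codim (range T)].

Definition essential_spectrum (T : bounded_op D H) : set R :=
  [set mu | ~ fredholm (T - mu *: iota)].

(* For a self-adjoint operator the algebraic and geometric multiplicities of an
   eigenvalue coincide. *)
Definition simple_eigenvalue (T : bounded_op D H) (mu : R) :=
  exists2 u, u != 0 & ker (T - mu *: iota) = range (fun a : R => a *: u).

End UnboundedOperators.

Definition C1 (R : realType) (V : normedModType R) (f : R -> V) :=
  (forall x, derivable f x 1) /\ continuous (derive1 f).

(* Main.v *)
(* Let [k0] be the supremum of the [k >= 0] for which the form [(L(k)u, u)] takes
   negative values.  The form of [L(k0)] is nonnegative, and [L(k0)] has closed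
   range, so it must have a kernel: otherwise it would be invertible, and
   [L(k)] would remain nonnegative for [k] near [k0].  The kernel is a line: any
   [u] in it orthogonal to the negative eigenvector of [L(0)] would satisfy
   [(L(k)u, u) = 0] on [[0, k0]], contradicting [(L'(k0)u, u) > 0].  Adding the
   orthogonal projection onto the kernel makes [L(k) - sigma A(k)] invertible near
   [(k0, 0)], and this reduces the problem to a scalar equation [g(sigma, k) = 0]
   which, since [(L'(k0)u, u) > 0], is solved by the intermediate value theorem
   for each small [sigma > 0]. *)
Require Import Defs.
From HB Require Import structures.
From mathcomp Require Import all_boot all_order all_algebra.
From mathcomp Require Import all_classical all_reals all_analysis.
From mathcomp Require Import ring lra.
Set Implicit Arguments.
Unset Strict Implicit.
Unset Printing Implicit Defensive.

Import Order.TTheory GRing.Theory Num.Theory.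
Import numFieldNormedType.Exports.
Local Open Scope classical_set_scope.
Local Open Scope ring_scope.

(** * Elementary real inequalities *)

Lemma discriminant_le (R : realFieldType) (a b c : R) :
  (forall s t, 0 <= s ^+ 2 * a + s * t * b *+ 2 + t ^+ 2 * c) -> b ^+ 2 <= a * c.
Proof.
move=> abc.
have a0 : 0 <= a by have := abc 1 0; lra.
have c0 : 0 <= c by have := abc 0 1; lra.
have [ce|cN] := eqVneq c 0; last first.
  have cp : 0 < c by rewrite lt_neqAle eq_sym cN.
  have := abc c (- b).
  have -> : c ^+ 2 * a + c * - b * b *+ 2 + (- b) ^+ 2 * c =
    c * (a * c - b ^+ 2) by ring.
  by rewrite pmulr_rge0// subr_ge0.
have := abc b (- (a + 1)); rewrite ce !mulr0 addr0.
have -> : b ^+ 2 * a + b * - (a + 1) * b *+ 2 = - (b ^+ 2 * (a + 2)) by ring.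
rewrite oppr_ge0 pmulr_lle0//; lra.
Qed.

(** Serves as the passage to the limit in estimates that hold up to a geometric error. *)
Lemma ler_all_expV2 (R : archiRealFieldType) (x M : R) :
  (forall n, x <= M * 2^-1 ^+ n) -> x <= 0.
Proof.
move=> xM; rewrite leNgt; apply/negP => x0.
have M0 : 0 < M by have := xM 0%N; rewrite expr0 mulr1; exact: lt_le_trans.
pose n := Num.bound (M / x).
have nM : M / x < n%:R by rewrite archi_boundP// divr_ge0 ?ltW.
have n2 : n%:R <= 2 ^+ n :> R by rewrite -natrX ler_nat ltnW// ltn_expl.
have := xM n; apply/negP; rewrite -ltNge exprVn ltr_pdivrMr ?exprn_gt0//.
by rewrite mulrC -ltr_pdivrMr// (lt_le_trans nM).
Qed.

(** * Cauchy sequences with an explicit rate *)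

Section cauchy_rate.
Variables (R : realType) (V : completeNormedModType R).

Lemma cauchy_rate_cvg (a : nat -> V) (e : nat -> R) :
  (forall n m, (n <= m)%N -> `|a m - a n| <= e n) -> e @ \oo --> (0 : R) ->
  exists l, a @ \oo --> l /\ forall n, `|l - a n| <= e n.
Proof.
move=> ae e0.
have : cvg (a @ \oo).
  apply/cauchy_cvgP/cauchy_exP => eps eps0.
  have /cvgr0Pnorm_lt /(_ eps eps0)[N _ Ne] := e0.
  exists (a N), N => // m /= Nm.
  rewrite -ball_normE /= distrC (le_lt_trans (ae _ _ Nm))//.
  by rewrite (le_lt_trans (ler_norm _))// Ne//=.
move=> /cvg_ex[l al]; exists l; split => // n.
have aln : (fun m => `|a m - a n|) @ \oo --> `|l - a n|.
  by apply: cvg_norm; apply: cvgB => //; exact: cvg_cst.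
apply: (cvgr_to_le aln).
by exists n => // m /= /ae.
Qed.

Lemma cvg_geometricV2 (M : R) : (fun n => M * 2^-1 ^+ n) @ \oo --> (0 : R).
Proof.
by apply: cvg_geometric; rewrite ger0_norm// invf_lt1// ltr1n.
Qed.

End cauchy_rate.

(** * Norm bounds for linear operators *)

Section operators.
Variables (R : realType) (V W : normedModType R).
Implicit Types T : bounded_op V W.

Lemma ler_op_norm T u : `|T u| <= `|T| * `|u|.
Proof.
have [->|u0] := eqVneq u 0; first by rewrite linear0 !normr0 mulr0.
have nu : 0 < `|u| by rewrite normr_gt0.
have : `|T (`|u|^-1 *: u)| <= `|T|.
  by apply: op_norm_ub; rewrite normrZ normfV normr_id mulVf// gt_eqF.
by rewrite linearZ normrZ normfV normr_id ler_pdivrMl// mulrC.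
Qed.

Lemma bounded_op_morphD T u v : T (u + v) = T u + T v.
Proof. exact: linearD. Qed.

Lemma bounded_op_morphB T u v : T (u - v) = T u - T v.
Proof. exact: linearB. Qed.

Lemma bounded_op_morphZ T a u : T (a *: u) = a *: T u.
Proof. exact: linearZ. Qed.

Lemma linear_bound_continuous (f : {linear V -> W}) (M : R) :
  (forall u, `|f u| <= M * `|u|) -> continuous f.
Proof.
move=> fM; apply/linear_bounded_continuous/linear_boundedP.
exists M; split; first exact: num_real.
by move=> N MN u; rewrite (le_trans (fM u))// ler_wpM2r// ltW.
Qed.

Lemma continuous_linear_bound (f : {linear V -> W}) :
  continuous f -> exists2 M, 0 < M & forall u, `|f u| <= M * `|u|.
Proof.
move=> /linear_bounded_continuous/linear_boundedP[M [_ fM]].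
exists (`|M| + 1); first by rewrite ltr_wpDl.
by move=> u; apply: fM; rewrite (le_lt_trans (ler_norm _))// ltrDl.
Qed.

End operators.

(** * Linear equations solved by successive correction *)

Section surjectivity.
Variables (R : realType) (V : completeNormedModType R) (W : normedModType R).

(** Applying the approximate inverse to the residual again and again halves the residual each time;
    the corrections sum to a geometric series, whence the factor 2. *)
Lemma approx_solvable (T : bounded_op V W) (M : R) :
  (forall y, exists u, `|u| <= M * `|y| /\ `|y - T u| <= 2^-1 * `|y|) ->
  forall y, exists u, T u = y /\ `|u| <= M * 2 * `|y|.
Proof.
move=> /choice[s sP] y.
pose a := fix a n := if n is m.+1 then a m + s (y - T (a m)) else 0.
have aS n : a n.+1 = a n + s (y - T (a n)) by [].
have ya n : `|y - T (a n)| <= 2^-1 ^+ n * `|y|.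
  elim: n => [|n IH]; first by rewrite linear0 subr0 expr0 mul1r.
  rewrite aS linearD opprD addrA (le_trans (sP _).2)//.
  by rewrite exprS -mulrA ler_pM2l.
have M0 : 0 <= M * `|y| by rewrite (le_trans _ (sP y).1).
(* The right-hand side is the telescoped sum of the step bounds [M * |y| * 2^-1 ^+ j] for
   [n <= j < m]. *)
have aa n m : (n <= m)%N ->
    `|a m - a n| <= M * `|y| * 2 * 2^-1 ^+ n - M * `|y| * 2 * 2^-1 ^+ m.
  elim: m => [|m IH]; first by rewrite leqn0 => /eqP ->; rewrite !subrr normr0.
  rewrite leq_eqVlt => /orP[/eqP ->|]; first by rewrite !subrr normr0.
  rewrite ltnS => /IH{}IH; rewrite aS addrAC (le_trans (ler_normD _ _))//.
  have sm : `|s (y - T (a m))| <= M * `|y| * 2^-1 ^+ m.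
    (* The sign of [M] is free: if [M <= 0], the norm is at most 0, while [M * |y|] is nonnegative
       by [M0]. *)
    have [M_ge0|/ltW M_le0] := leP 0 M.
      by rewrite (le_trans (sP _).1)// -mulrA ler_wpM2l// mulrC.
    rewrite (le_trans (sP _).1)// (@le_trans _ _ 0)//.
      by rewrite mulr_le0_ge0.
    by rewrite mulr_ge0// exprn_ge0.
  have E : 2^-1 ^+ m.+1 = 2^-1 * 2^-1 ^+ m :> R by rewrite exprS.
  by move: IH sm; rewrite E; lra.
have [] := @cauchy_rate_cvg R V a (fun n => M * `|y| * 2 * 2^-1 ^+ n).
- move=> n m /aa/le_trans; apply; rewrite lerBlDr lerDl.
  by rewrite mulr_ge0 ?exprn_ge0// mulr_ge0.
- exact: cvg_geometricV2.
move=> l [al la]; exists l; split; last first.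
  by have := la 0%N; rewrite subr0 expr0 mulr1 mulrAC.
have Tal : T (a n) @[n --> \oo] --> T l.
  by apply: (cvg_comp _ _ al); exact: bounded_op_continuous.
apply: (cvg_unique _ Tal) => //; apply/cvgrPdist_le => e e0.
have /cvgr0Pnorm_le /(_ e e0) := @cvg_geometricV2 R `|y|.
apply: filterS => n /= ne; rewrite (le_trans (ya n))// mulrC.
by rewrite (le_trans _ ne)// ler_norm.
Qed.

(** A solution of [T u = y] solves [S u = y] up to an error of [|y| / 2], so [approx_solvable]
    applies to [S]; the bound follows by absorbing [(S - T) u] into [u]. *)
Lemma perturbed_solvable (T S : bounded_op V W) (C : R) :
  (forall u, `|u| <= C * `|T u|) -> (forall y, exists u, T u = y) ->
  C * `|S - T| <= 2^-1 ->
  (forall y, exists u, S u = y) /\ forall u, `|u| <= C * 2 * `|S u|.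
Proof.
move=> CT surT ST.
have STu u : C * `|(S - T) u| <= 2^-1 * `|u|.
  have [C0|/ltW C0] := leP 0 C.
    rewrite (le_trans (ler_wpM2l C0 (ler_op_norm _ _)))// mulrA.
    by rewrite ler_wpM2r.
  by rewrite (@le_trans _ _ 0) ?mulr_ge0// mulr_le0_ge0.
split.
  move=> y; have [] := @approx_solvable S C _ y; last by move=> u [Su _]; exists u.
  move=> {}y; have [u Tu] := surT y; exists u; rewrite -Tu; split; first exact: CT.
  rewrite -opprB normrN -bounded_opB (le_trans (ler_op_norm _ _))//.
  rewrite (le_trans (ler_wpM2l _ (CT u)))// mulrCA mulrA ler_wpM2r//.
move=> u; have := STu u; have := CT u.
have : `|T u| <= `|S u| + `|(S - T) u|.
  by rewrite bounded_opB distrC -{1}(subrK (S u) (T u)) [leRHS]addrC ler_normD.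
have [C0|/ltW C0] := leP 0 C; last first.
  move=> _ h _.
  have : `|u| <= 0 by rewrite (le_trans h)// mulr_le0_ge0.
  rewrite normr_le0 => /eqP ->; rewrite linear0 !normr0 mulr0//.
move=> /(ler_wpM2l C0); rewrite mulrDr; lra.
Qed.

End surjectivity.

(** * The open mapping theorem *)

Section open_mapping.
Variables (R : realType) (V W : completeNormedModType R).

Lemma closure_distP (U : normedModType R) (A : set U) (x : U) :
  closure A x <-> forall e, 0 < e -> exists2 y, A y & `|x - y| < e.
Proof.
split=> [Ax e e0|Ax B /nbhs_ballP[e /= e0 xeB]].
  have [y [Ay]] := Ax _ (nbhsx_ballx x e e0).
  by rewrite -ball_normE; exists y.
have [y Ay xy] := Ax e e0.
by exists y; split => //; apply: xeB; rewrite -ball_normE.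
Qed.

(** By Baire, the closure of the image of some ball contains a ball; differences of points of that
    image give approximate preimages, which [approx_solvable] makes exact. *)
Lemma bounded_inverse (T : bounded_op V W) :
  injective T -> (forall y, exists u, T u = y) ->
  exists2 C, 0 < C & forall u, `|u| <= C * `|T u|.
Proof.
move=> injT surT.
pose F (n : nat) : set W := ~` closure [set T u | u in [set u : V | `|u| <= n%:R]].
have [n nF] : exists n, ~ dense (F n).
  apply/not_existsP => dF.
  have /(_ setT) : dense (\bigcap_i F i).
    apply: Baire => i; split; last by apply: contrapT; exact: dF.
    by rewrite openC; exact: closed_closure.
  move=> [||y [_ Fy]]; [by exists 0|exact: openT|].
  have [u Tu] := surT y.
  have := Fy (Num.bound `|u|) I; apply; apply: subset_closure.
  by exists u => //=; rewrite ltW// archi_boundP.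
have [y0 [r r0 y0r]] : exists y0, exists2 r, 0 < r & forall y, `|y0 - y| < r ->
    closure [set T u | u in [set u : V | `|u| <= n%:R]] y.
  move: nF => /denseNE[Q [[x /open_nbhs_nbhs/nbhs_ballP[r r0 xrQ] QF]]].
  exists x, r => // y xy; apply: contrapT => Fy.
  suff : (Q `&` F n) y by rewrite QF.
  by split => //; apply: xrQ; rewrite -ball_normE.
(* A difference of two points of the ball has norm at most [2 * n]; dividing it by
   [t = r / (2 * |y|)] gives [M * |y|]. *)
pose M := n%:R * 4 / r.
have solve : forall y, exists u, T u = y /\ `|u| <= M * 2 * `|y|.
  apply: approx_solvable => y.
  have [->|yn0] := eqVneq y 0.
    by exists 0; rewrite linear0 subrr !normr0 !mulr0.
  have ny : 0 < `|y| by rewrite normr_gt0.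
  (* This scaling keeps [y0 + t *: y] within [r] of [y0]; two approximations within [t * |y| / 4]
     leave an error of at most [|y| / 2] after division by [t]. *)
  pose t := r / 2 / `|y|.
  have t0 : 0 < t by rewrite !divr_gt0.
  have ty : t * `|y| = r / 2 by rewrite divfK// gt_eqF.
  have e0 : 0 < t * `|y| / 4 by rewrite ty !divr_gt0.
  have [_ [u1 /= u1n <-] Tu1] : exists2 z,
      [set T u | u in [set u : V | `|u| <= n%:R]] z & `|y0 - z| < t * `|y| / 4.
    by apply/(closure_distP _ _).1 => //; apply: y0r; rewrite subrr normr0.
  have [_ [u2 /= u2n <-] Tu2] : exists2 z,
      [set T u | u in [set u : V | `|u| <= n%:R]] z &
      `|y0 + t *: y - z| < t * `|y| / 4.
    apply/(closure_distP _ _).1 => //; apply: y0r.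
    rewrite opprD addrA subrr sub0r normrN normrZ gtr0_norm// ty.
    by rewrite ltr_pdivrMr// ltr_pMr// ltr1n.
  exists (t^-1 *: (u2 - u1)); split.
    rewrite normrZ gtr0_norm ?invr_gt0// ler_pdivrMl//.
    have -> : t * (M * `|y|) = n%:R * 2.
      have -> : M * `|y| = n%:R * 2 * t^-1.
        by rewrite /M /t !invf_div; field; rewrite !gt_eqF.
      by rewrite mulrC divfK// gt_eqF.
    by rewrite (le_trans (ler_normB _ _))// mulr_natr mulr2n lerD.
  rewrite linearZ linearB.
  have -> : y - t^-1 *: (T u2 - T u1) =
      t^-1 *: ((y0 + t *: y - T u2) - (y0 - T u1)).
    rewrite -[in LHS](scale1r y) -(mulVf (lt0r_neq0 t0)) -scalerA -scalerBr.
    congr (_ *: _); rewrite !opprB [y0 + _]addrC -!addrA; congr (_ + _).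
    by rewrite [RHS]addrC -!addrA addNr addr0 addrC.
  rewrite normrZ gtr0_norm ?invr_gt0// ler_pdivrMl//.
  by rewrite (le_trans (ler_normB _ _))//; lra.
exists (`|M * 2| + 1); first by rewrite ltr_wpDl.
move=> u; have [v [/injT -> vM]] := solve (T u).
by rewrite (le_trans vM)// ler_wpM2r// (le_trans (ler_norm _))// lerDl.
Qed.

End open_mapping.

(** * Hilbert space geometry: Cauchy-Schwarz and orthogonal projection *)

Section hilbert.
Variables (R : realType) (H : completeNormedModType R) (dot : {dot H for idfun}).
Hypothesis dot_norm : forall u : H, `|u| ^+ 2 = dot u u.
Implicit Types u v w : H.

Lemma dotC u v : dot u v = dot v u.
Proof. by rewrite hermC /= expr0 mul1r. Qed.

Lemma dotDl u v w : dot (u + v) w = dot u w + dot v w.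
Proof. exact: linearDl. Qed.

Lemma dotDr u v w : dot u (v + w) = dot u v + dot u w.
Proof. exact: linearDr. Qed.

Lemma dotBl u v w : dot (u - v) w = dot u w - dot v w.
Proof. exact: linearBl. Qed.

Lemma dotBr u v w : dot u (v - w) = dot u v - dot u w.
Proof. exact: linearBr. Qed.

Lemma dotZl a u v : dot (a *: u) v = a * dot u v.
Proof. exact: linearZl_LR. Qed.

Lemma dotZr a u v : dot u (a *: v) = a * dot u v.
Proof. exact: linearZr_LR. Qed.

Lemma dot0l u : dot 0 u = 0.
Proof. exact: linear0l. Qed.

Lemma dot0r u : dot u 0 = 0.
Proof. exact: linear0r. Qed.

Lemma sqr_normD u v : `|u + v| ^+ 2 = `|u| ^+ 2 + dot u v *+ 2 + `|v| ^+ 2.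
Proof. by rewrite !dot_norm dotDl !dotDr (dotC v u) mulr2n !addrA. Qed.

Lemma sqr_normB u v : `|u - v| ^+ 2 = `|u| ^+ 2 - dot u v *+ 2 + `|v| ^+ 2.
Proof. by rewrite sqr_normD -scaleN1r dotZr normrZ normrN1 mul1r mulN1r mulNrn. Qed.

Lemma ler_dot_norm u v : `|dot u v| <= `|u| * `|v|.
Proof.
rewrite -ler_sqr ?nnegrE ?mulr_ge0// exprMn real_normK ?num_real// !dot_norm.
apply: discriminant_le => s t; have := sqr_ge0 `|s *: u + t *: v|.
rewrite dot_norm dotDl !dotDr !dotZl !dotZr (dotC v u).
by congr (0 <= _); ring.
Qed.

(** The foot [p] is the limit of a minimizing sequence in [W], hence lies in the closure of [W]. *)
Lemma orthogonal_projection (W : set H) v :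
  W 0 -> (forall a x y, W x -> W y -> W (a *: x + y)) ->
  exists2 p, closure W p & forall w, W w -> dot (v - p) w = 0.
Proof.
move=> W0 Wlin.
pose E := [set `|v - w| ^+ 2 | w in W]; pose d := inf E.
have hE : has_inf E.
  by split; [exists (`|v - 0| ^+ 2), 0|exists 0 => _ [w _ <-]; exact: sqr_ge0].
have dE w : W w -> d <= `|v - w| ^+ 2.
  by move=> Ww; apply: (ge_inf hE.2); exists w.
(* The error is a square because the parallelogram identity at the midpoint turns it into a distance
   of at most [2 * 2^-1 ^+ n] between minimizers. *)
have /choice[a aP] : forall n, exists w,
    W w /\ `|v - w| ^+ 2 <= d + (2^-1 ^+ n) ^+ 2.
  move=> n; have e0 : 0 < (2^-1 ^+ n) ^+ 2 :> R by rewrite !exprn_gt0// invr_gt0.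
  have [_ [w Ww <-] wd] := inf_adherent e0 hE.
  by exists w; split => //; exact: ltW.
have aa n m : (n <= m)%N -> `|a m - a n| <= 2 * 2^-1 ^+ n.
  move=> nm; rewrite -ler_sqr ?nnegrE ?mulr_ge0 ?exprn_ge0// ?invr_ge0//.
  have [[Wn an] [Wm am]] := (aP n, aP m).
  have Wh : W (2^-1 *: a m + 2^-1 *: a n).
    by apply: (Wlin _ _ _) => //; rewrite -[_ *: _]addr0; exact: Wlin.
  have := dE _ Wh.
  have -> : `|v - (2^-1 *: a m + 2^-1 *: a n)| ^+ 2 =
      2^-1 * `|v - a m| ^+ 2 + 2^-1 * `|v - a n| ^+ 2 - 4^-1 * `|a m - a n| ^+ 2.
    rewrite !dot_norm !(dotBl, dotBr, dotDl, dotDr, dotZl, dotZr).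
    by rewrite (dotC (a m) v) (dotC (a n) v) (dotC (a n) (a m)); field.
  have : (2^-1 ^+ m) ^+ 2 <= (2^-1 ^+ n) ^+ 2 :> R.
    rewrite ler_sqr ?nnegrE ?exprn_ge0 ?invr_ge0// ler_wiXn2l ?invr_ge0//.
    by rewrite invf_le1// ler1n.
  rewrite exprMn; move: am an; lra.
have [] := cauchy_rate_cvg aa; first exact: cvg_geometricV2.
move=> p [_ pa]; exists p.
  apply/closure_distP => e e0.
  have /cvgr0Pnorm_lt /(_ e e0)[N _ /(_ N (leqnn N)) Ne] := @cvg_geometricV2 R 2.
  exists (a N); first exact: (aP N).1.
  by rewrite (le_lt_trans (pa N))// (le_lt_trans (ler_norm _) Ne).
move=> w Ww; apply/eqP; rewrite -normr_le0.
apply: (@ler_all_expV2 _ _ (3 * `|w|)) => n.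
(* Moving [a n] along [w] cannot lower the squared distance by more than [(2^-1 ^+ n) ^+ 2]; the
   discriminant of the resulting quadratic form gives the bound. *)
have b : `|dot (v - a n) w| <= 2^-1 ^+ n * `|w|.
  have e0 : 0 <= 2^-1 ^+ n :> R by rewrite exprn_ge0// invr_ge0.
  rewrite -ler_sqr ?nnegrE ?mulr_ge0// exprMn real_normK ?num_real//.
  apply: discriminant_le => s t.
  have [->|s0] := eqVneq s 0.
    by rewrite expr0n/= !mul0r mul0rn !add0r mulr_ge0 ?sqr_ge0.
  have [Wn an] := aP n.
  have := dE _ (Wlin (- (t / s)) _ _ Ww Wn).
  have -> : v - (- (t / s) *: w + a n) = (v - a n) + (t / s) *: w.
    by rewrite scaleNr opprD opprK addrCA addrC.
  rewrite sqr_normD dotZr normrZ exprMn real_normK ?num_real// => dd.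
  have : 0 <= (2^-1 ^+ n) ^+ 2 + t / s * dot (v - a n) w *+ 2 + (t / s) ^+ 2 * `|w| ^+ 2.
    by move: dd an; lra.
  rewrite -(pmulr_rge0 _ (_ : 0 < s ^+ 2)) ?exprn_even_gt0//.
  by congr (0 <= _); field.
have -> : v - p = (v - a n) - (p - a n) by rewrite opprB addrA subrK.
rewrite dotBl (le_trans (ler_normB _ _))//.
have := ler_dot_norm (p - a n) w.
have := ler_wpM2r (normr_ge0 w) (pa n).
by move: b; lra.
Qed.

End hilbert.

(** * Self-adjoint operators: range, kernel and spectral gaps *)

Section self_adjoint_operators.
Variables (R : realType) (H : completeNormedModType R) (dot : {dot H for idfun}).
Hypothesis dot_norm : forall u : H, `|u| ^+ 2 = dot u u.
Variables (D : completeNormedModType R) (iota : bounded_op D H).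
Implicit Types T B : bounded_op D H.

Definition symmetric_op T := forall u v, dot (T u) (iota v) = dot (iota u) (T v).

Lemma self_adjoint_symmetric T : self_adjoint dot iota T -> symmetric_op T.
Proof.
move=> [_ adj] u v.
by apply: (adj (iota v) (T v)).2; exists v.
Qed.

Lemma symmetric_opB S T : symmetric_op S -> symmetric_op T -> symmetric_op (S - T).
Proof. by move=> sS sT u v; rewrite !bounded_opB dotBl dotBr sS sT. Qed.

Lemma symmetric_op_shift T a : symmetric_op T -> symmetric_op (T - a *: iota).
Proof.
move=> sT u v; rewrite !bounded_opB !bounded_opZ.
by rewrite dotBl dotBr dotZl dotZr sT.
Qed.

(** A vector orthogonal to the range lies in the domain of the adjoint, with image 0, and the
    adjoint is [T] itself. *)
Lemma orthogonal_range_ker T w :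
  self_adjoint dot iota T -> (forall u, dot (T u) w = 0) ->
  exists u, w = iota u /\ T u = 0.
Proof.
move=> [_ adj] Tw.
have [|u [wu Tu]] := (adj w 0).1; last by exists u; split.
by move=> u; rewrite dot0r Tw.
Qed.

(** What remains of [f] after projection onto the closed range is orthogonal to the range, hence in
    the kernel. *)
Lemma range_orthogonal_decomposition T f :
  self_adjoint dot iota T ->
  exists p u, [/\ closure (range T) p, T u = 0 & f = p + iota u].
Proof.
move=> sT.
have [||p cp pf] := @orthogonal_projection R H dot dot_norm (range T) f.
- by exists 0 => //; rewrite linear0.
- by move=> a _ _ [x _ <-] [y _ <-]; exists (a *: x + y) => //; rewrite linearP.
have [u|u [wu Tu]] := @orthogonal_range_ker T (f - p) sT.
  by rewrite dotC; apply: pf; exists u.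
by exists p, u; split => //; rewrite -wu addrCA subrr addr0.
Qed.

Lemma resolvent_setP T t : resolvent_set iota T t ->
  (forall f, exists u, (T - t *: iota) u = f) /\
  exists2 c, 0 < c & forall u, c * `|iota u| <= `|(T - t *: iota) u|.
Proof.
move=> [S [TS ST cS]]; split; first by move=> f; exists (S f); exact: ST.
have linS : linear (iota \o S).
  move=> a x y /=; rewrite -[x in LHS]ST -[y in LHS]ST -linearP TS.
  by rewrite linearP.
pose f : {linear H -> H} :=
  HB.pack (iota \o S) (GRing.isLinear.Build R H H _ (iota \o S) linS).
have [M M0 fM] := @continuous_linear_bound _ _ _ f cS.
exists M^-1; first by rewrite invr_gt0.
move=> u; rewrite ler_pdivrMl//.
by have := fM ((T - t *: iota) u); rewrite /= TS.
Qed.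

(* If [q] is the supremum of the [x] with [x |u|^2 <= |T u|^2] and
   [rho = sqrt q], then [T u - q v = (T - rho) (u + rho v)] and
   [T (u + rho v) = (T + rho) u] for [T v = u]; invertibility of [T - rho] and
   [T + rho] thus bounds [|T u - q v|^2 <= |T u|^2 - q |u|^2] below by a
   multiple of [|u|^2]. *)
Lemma symmetric_op_gap T r : 0 < r -> symmetric_op T ->
  (forall t, `|t| < r -> resolvent_set iota T t) ->
  forall u, r * `|iota u| <= `|T u|.
Proof.
move=> r0 sT rT; apply: contrapT => /existsNP[u0 /negP]; rewrite -ltNge => u0r.
pose E : set R := [set x | forall u, x * `|iota u| ^+ 2 <= `|T u| ^+ 2].
have E0 : E 0 by move=> u; rewrite mul0r sqr_ge0.
have Er : ~ E (r ^+ 2).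
  move=> /(_ u0); rewrite -exprMn ler_sqr ?nnegrE ?mulr_ge0 ?(ltW r0)//.
  by rewrite leNgt u0r.
have ubE : ubound E (r ^+ 2).
  move=> x Ex; rewrite leNgt; apply/negP => rx; apply: Er => u.
  by rewrite (le_trans _ (Ex u))// ler_wpM2r ?sqr_ge0// ltW.
have hE : has_sup E by split; [exists 0|exists (r ^+ 2)].
pose q := sup E.
have Eq : E q.
  move=> u; have [->|u_n0] := eqVneq (iota u) 0.
    by rewrite normr0 expr0n/= mulr0 sqr_ge0.
  have u2 : 0 < `|iota u| ^+ 2 by rewrite exprn_gt0// normr_gt0.
  rewrite -ler_pdivlMr//; apply: ge_sup; first by exists 0.
  by move=> x /(_ u); rewrite ler_pdivlMr.
have q0 : 0 <= q by apply: sup_upper_bound.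
have qr : q < r ^+ 2.
  rewrite lt_neqAle; apply/andP; split; last by apply: ge_sup ubE; exists 0.
  by apply/eqP => qr; apply: Er; rewrite -qr.
pose rho := Num.sqrt q.
have rho2 : rho ^+ 2 = q by rewrite sqr_sqrtr.
have rho0 : 0 <= rho by exact: sqrtr_ge0.
have rhor : rho < r by rewrite -ltr_sqr ?nnegrE ?rho2// ltW.
have [|surT _] := resolvent_setP (rT 0 _); first by rewrite normr0.
have [|_ [c1 c10 c1P]] := resolvent_setP (rT rho _); first by rewrite ger0_norm.
have [|_ [c2 c20 c2P]] := resolvent_setP (rT (- rho) _).
  by rewrite normrN ger0_norm.
(* With [z = u + rho v], eliminating [|z|] from [c1 |z| <= eta] and [c2 |u| <= eta + rho |z|] gives
   [kappa |u| <= eta]. *)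
pose kappa := c1 * c2 / (c1 + rho).
have c1rho : 0 < c1 + rho by rewrite ltr_wpDr.
have kappa0 : 0 < kappa by rewrite divr_gt0// mulr_gt0.
suff : E (q + kappa ^+ 2).
  move=> /(sup_upper_bound hE); rewrite -/q gerDl leNgt exprn_gt0//.
move=> u; have [v] := surT (iota u).
rewrite scale0r subr0 => Tv.
pose eta := `|T u - q *: iota v|.
have eta_le : eta ^+ 2 <= `|T u| ^+ 2 - q * `|iota u| ^+ 2.
  have -> : eta ^+ 2 = `|T u| ^+ 2 - q * `|iota u| ^+ 2 *+ 2 + q ^+ 2 * `|iota v| ^+ 2.
    (* By symmetry [(T u, v) = (u, T v) = |u|^2]; then [Eq v] bounds [q^2 |v|^2] by [q |u|^2]. *)
    rewrite /eta (sqr_normB dot_norm) dotZr normrZ ger0_norm// exprMn.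
    by rewrite sT Tv -dot_norm.
  have := ler_wpM2l q0 (Eq v); rewrite Tv; lra.
have etaE : T u - q *: iota v = (T - rho *: iota) (u + rho *: v).
  rewrite bounded_opB bounded_opZ !bounded_op_morphD.
  rewrite !bounded_op_morphZ Tv -rho2 expr2 -scalerA.
  by rewrite scalerDr opprD addrA addrK.
have c1z : c1 * `|iota (u + rho *: v)| <= eta by rewrite /eta etaE.
have c2u : c2 * `|iota u| <= eta + rho * `|iota (u + rho *: v)|.
  rewrite (le_trans (c2P u))// /eta etaE.
  have -> : (T - (- rho) *: iota) u =
      (T - rho *: iota) (u + rho *: v) + rho *: iota (u + rho *: v).
    rewrite !bounded_opB !bounded_opZ subrK bounded_op_morphD.
    by rewrite bounded_op_morphZ Tv scaleNr opprK.
  by rewrite (le_trans (ler_normD _ _))// normrZ (ger0_norm rho0).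
have ku : kappa * `|iota u| <= eta.
  rewrite /kappa mulrAC ler_pdivrMr// -mulrA.
  have := ler_wpM2l (ltW c10) c2u; have := ler_wpM2l rho0 c1z.
  nra.
rewrite mulrDl -exprMn -lerBrDl (le_trans _ eta_le)//.
by apply: lerXn2r ku; rewrite nnegrE; [rewrite mulr_ge0// ltW|exact: normr_ge0].
Qed.

Lemma resolvent_set_shift T a t :
  resolvent_set iota T (a + t) -> resolvent_set iota (T - a *: iota) t.
Proof. by move=> [S SP]; exists S; rewrite -addrA -opprD -scalerDl. Qed.

Lemma symmetric_op_shift_gap T a r : 0 < r -> symmetric_op T ->
  (forall t, `|t - a| < r -> resolvent_set iota T t) ->
  forall u, r * `|iota u| <= `|T u - a *: iota u|.
Proof.
move=> r0 sT rT u; rewrite -bounded_opZ -bounded_opB.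
apply: symmetric_op_gap u => //; first exact: symmetric_op_shift.
by move=> t tr; apply/resolvent_set_shift/rT; rewrite addrAC subrr add0r.
Qed.

End self_adjoint_operators.

Lemma ler_scaled_sqr (R : realDomainType) (a x y : R) :
  0 <= a -> 0 <= x -> a * x <= y -> a ^+ 2 * x ^+ 2 <= y ^+ 2.
Proof.
move=> a0 x0 axy; have ax0 : 0 <= a * x by rewrite mulr_ge0.
by rewrite -exprMn ler_sqr ?nnegrE// (le_trans ax0).
Qed.

(** * Nonnegative forms: coercivity and stability under perturbation *)

Section semidefinite_operators.
Variables (R : realType) (H : completeNormedModType R) (dot : {dot H for idfun}).
Hypothesis dot_norm : forall u : H, `|u| ^+ 2 = dot u u.
Variables (D : completeNormedModType R) (iota : bounded_op D H).
Implicit Types T B : bounded_op D H.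

Lemma semidefinite_CauchySchwarz T : symmetric_op dot iota T ->
  (forall u, 0 <= dot (T u) (iota u)) ->
  forall u v, dot (T u) (iota v) ^+ 2 <= dot (T u) (iota u) * dot (T v) (iota v).
Proof.
move=> sT T0 u v; apply: discriminant_le => s t.
have := T0 (s *: u + t *: v).
rewrite !bounded_op_morphD !bounded_op_morphZ !dotDl !dotDr !dotZl !dotZr.
by rewrite (sT v u) (dotC _ (iota v)); congr (0 <= _); ring.
Qed.

Lemma self_adjoint_shift T a :
  self_adjoint dot iota T -> self_adjoint dot iota (T - a *: iota).
Proof.
move=> [dD adj]; split => // v w; split.
  move=> vw; have [|u [vu wu]] := (adj v (w + a *: v)).1.
    move=> u; have := vw u.
    rewrite bounded_opB bounded_opZ dotBl dotZl dotDr dotZr => <-.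
    by rewrite subrK.
  by exists u; split => //; rewrite bounded_opB bounded_opZ -wu -vu addrK.
move=> [u [-> ->]] x.
rewrite !bounded_opB !bounded_opZ dotBl dotBr dotZl dotZr.
by congr (_ - _); apply: (adj (iota u) (T u)).2; exists u.
Qed.

(* Let the radius of a gap centred at [- r] go to infinity. *)
Lemma resolvent_semidefinite T : symmetric_op dot iota T ->
  (forall t, t < 0 -> resolvent_set iota T t) ->
  forall u, 0 <= dot (T u) (iota u).
Proof.
move=> sT rT u; rewrite leNgt; apply/negP => x0.
pose x := dot (T u) (iota u).
have d0 : 0 < - (x *+ 2) by rewrite oppr_gt0 pmulrn_llt0.
(* This [r] makes [|T u + r u|^2 - r^2 |u|^2 = |T u|^2 + 2 r x] equal to [-1], against the gap of
   radius [r] centred at [- r]. *)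
have [r r0 rx] : exists2 r, 0 < r & r * x *+ 2 = - (`|T u| ^+ 2 + 1).
  exists ((`|T u| ^+ 2 + 1) / (- (x *+ 2))).
    by rewrite divr_gt0// ltr_wpDl ?sqr_ge0.
  by rewrite -mulrnAr -[x *+ 2]opprK mulrN opprK divfK// gt_eqF.
have := @symmetric_op_shift_gap _ _ _ dot_norm _ _ T (- r) r r0 sT _ u.
have rT' t : `|t - - r| < r -> resolvent_set iota T t.
  by rewrite opprK ltr_norml => /andP[_ tr]; apply: rT; rewrite -(gtrDr r).
move=> /(_ rT')/(ler_scaled_sqr (ltW r0) (normr_ge0 _)).
rewrite scaleNr opprK (sqr_normD dot_norm) dotZr normrZ exprMn.
by rewrite (gtr0_norm r0) -/x lerDr rx opprD addrA subrr add0r oppr_ge0 ler10.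
Qed.

(* The gap [(0, lam)] gives [lam (T v, v) <= |T v|^2]; then apply Cauchy-Schwarz
   for the form [(T u, v)] to a sequence with [T v] tending to [u]. *)
Lemma spectral_gap_coercive T lam : 0 < lam -> self_adjoint dot iota T ->
  (forall t, t < lam -> t != 0 -> resolvent_set iota T t) ->
  forall u, (forall z, T z = 0 -> dot (iota u) (iota z) = 0) ->
  lam * `|iota u| ^+ 2 <= dot (T u) (iota u).
Proof.
move=> lam0 saT rT u uz.
have sT := self_adjoint_symmetric saT.
have T0 v : 0 <= dot (T v) (iota v).
  by apply: resolvent_semidefinite => // t t0; apply: rT; lra.
have T2 v : lam * dot (T v) (iota v) <= `|T v| ^+ 2.
  have l0 : 0 < lam / 2 by rewrite divr_gt0.
  have := @symmetric_op_shift_gap _ _ _ dot_norm _ _ T (lam / 2) (lam / 2) l0 sT _ v.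
  have rT' t : `|t - lam / 2| < lam / 2 -> resolvent_set iota T t.
    by rewrite ltr_norml => /andP[? ?]; apply: rT; lra.
  move=> /(_ rT')/(ler_scaled_sqr (ltW l0) (normr_ge0 _)).
  rewrite (sqr_normB dot_norm) dotZr normrZ exprMn (gtr0_norm l0).
  lra.
set x := dot (T u) (iota u); set m := `|iota u|.
have [m0|mN] := eqVneq m 0; first by rewrite m0 expr0n/= mulr0 T0.
have m0 : 0 < m by rewrite lt_neqAle eq_sym mN normr_ge0.
have approx d : 0 < d -> exists v, `|iota u - T v| <= d.
  move=> d0; have [p [z [cp Tz uE]]] :=
    range_orthogonal_decomposition dot_norm (iota u) saT.
  have [_ [v _ <-] pv] : exists2 y, range T y & `|p - y| < d / 2.
    by apply/(closure_distP _ _).1 => //; rewrite divr_gt0.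
  (* The kernel component [z] of [u] is small: it is orthogonal to both [u] and [T v], so
     [|z|^2 = - (p - T v, z)]. *)
  have zd : `|iota z| <= d / 2.
    have [->|z0] := eqVneq `|iota z| 0; first by rewrite divr_ge0// ltW.
    have nz : 0 < `|iota z| by rewrite lt_neqAle eq_sym z0 normr_ge0.
    rewrite -(ler_pM2r nz) -expr2 dot_norm.
    have -> : dot (iota z) (iota z) = - dot (p - T v) (iota z).
      apply/eqP; rewrite -addr_eq0 -dotDl addrC addrAC -uE dotBl uz// sT Tz.
      by rewrite dot0r subrr.
    rewrite (le_trans (ler_norm _))// normrN.
    rewrite (le_trans (ler_dot_norm dot_norm _ _))//.
    by rewrite ler_wpM2r// ltW.
  exists v; rewrite uE addrAC (le_trans (ler_normD _ _))//.
  by move: pv zd; lra.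
(* The goal is reached from [lam m^2 (1 - e)^2 <= x (1 + e)^2]; the constants come from
   [(1 - e)^2 >= 1 - 2 e] and, for [e <= 1], [(1 + e)^2 <= 1 + 3 e]. *)
rewrite -subr_le0; apply: (@ler_all_expV2 _ _ (lam * m ^+ 2 * 2 + x * 3)) => n.
set e := 2^-1 ^+ n.
have e0 : 0 < e by rewrite exprn_gt0// invr_gt0.
have e1 : e <= 1 by rewrite exprn_ile1// ?invr_ge0// invf_le1// ler1n.
have [v uv] := approx (e * m) (mulr_gt0 e0 m0).
have Tv : `|T v| <= m * (1 + e).
  have := lerB_dist (T v) (iota u); rewrite distrC -/m; lra.
have dv : m ^+ 2 * (1 - e) <= dot (T u) (iota v).
  have -> : dot (T u) (iota v) = m ^+ 2 - dot (iota u) (iota u - T v).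
    by rewrite sT dotBr /m dot_norm opprB addrCA subrr addr0.
  have := ler_wpM2l (ltW m0) uv.
  have := ler_dot_norm dot_norm (iota u) (iota u - T v).
  have := ler_norm (dot (iota u) (iota u - T v)); rewrite -/m; lra.
have x0 : 0 <= x := T0 u.
have CS := semidefinite_CauchySchwarz sT T0 u v.
have h : lam * (m ^+ 2 * (1 - e)) ^+ 2 <= x * (m * (1 + e)) ^+ 2.
  rewrite (@le_trans _ _ (x * `|T v| ^+ 2))//; last first.
    rewrite ler_wpM2l// ler_sqr ?nnegrE// mulr_ge0 ?(ltW m0)//.
    by rewrite addr_ge0 ?(ltW e0).
  rewrite (le_trans _ (ler_wpM2l x0 (T2 v)))// [leRHS]mulrCA ler_pM2l//.
  rewrite (le_trans _ CS)// ler_sqr ?nnegrE//.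
    by rewrite mulr_ge0 ?sqr_ge0// subr_ge0.
  by rewrite (le_trans _ dv)// mulr_ge0 ?sqr_ge0// subr_ge0.
have m2 : 0 < m ^+ 2 by rewrite exprn_gt0.
have {}h : lam * m ^+ 2 * (1 - e) ^+ 2 <= x * (1 + e) ^+ 2.
  rewrite -(ler_pM2l m2); move: h; congr (_ <= _); ring.
have := mulr_ge0 (mulr_ge0 x0 (ltW e0)) (_ : 0 <= 1 - e).
have := mulr_ge0 (mulr_ge0 (ltW lam0) (ltW m2)) (sqr_ge0 e).
rewrite subr_ge0 => ? /(_ e1); nra.
Qed.

(* [K = T^-1 B] is symmetric for the form [q u v = (T u, v)], so
   Cauchy-Schwarz makes [n |-> q (K^n u) (K^n u)] log-convex; as [K] is a
   contraction of [D] this sequence tends to [0], hence does not start by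
   increasing, and [|q (K u) u| <= q u u]. *)
Lemma perturbed_semidefinite T B C :
  symmetric_op dot iota T -> symmetric_op dot iota B ->
  (forall u, 0 <= dot (T u) (iota u)) ->
  (forall u, `|u| <= C * `|T u|) -> (forall y, exists u, T u = y) ->
  0 <= C -> C * `|B| <= 2^-1 ->
  forall u, 0 <= dot ((T + B) u) (iota u).
Proof.
move=> sT sB T0 CT surT C0 CB u.
have [s sP] := choice (fun v => surT (B v)).
pose x n := iter n s u.
have xS n : T (x n.+1) = B (x n) by exact: sP.
have x_le n : `|x n| <= 2^-1 ^+ n * `|u|.
  elim: n => [|n IH]; first by rewrite expr0 mul1r.
  rewrite (le_trans (CT _))// xS.
  rewrite (le_trans (ler_wpM2l C0 (ler_op_norm _ _)))// mulrA.
  by rewrite exprS -[leRHS]mulrA ler_pM ?mulr_ge0.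
pose a n := dot (T (x n)) (iota (x n)).
have a0 n : 0 <= a n by exact: T0.
have a_convex n : a n.+1 ^+ 2 <= a n * a n.+2.
  rewrite [a n.+1](_ : _ = dot (T (x n)) (iota (x n.+2))).
    exact: (semidefinite_CauchySchwarz sT T0).
  by rewrite /a xS sB -xS -sT.
have a_le n : a n <= `|T| * `|iota| * `|u| ^+ 2 * 2^-1 ^+ n.
  rewrite (le_trans (ler_norm _))// (le_trans (ler_dot_norm dot_norm _ _))//.
  rewrite (le_trans (ler_pM _ _ (ler_op_norm _ _) (ler_op_norm _ _)))//.
  have h : `|x n| ^+ 2 <= `|u| ^+ 2 * 2^-1 ^+ n.
    have e0 : 0 <= 2^-1 ^+ n :> R by rewrite exprn_ge0// invr_ge0.
    have e1 : 2^-1 ^+ n <= 1 :> R by rewrite exprn_ile1// ?invr_ge0// invf_le1// ler1n.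
    rewrite (@le_trans _ _ ((2^-1 ^+ n * `|u|) ^+ 2))//.
      by apply: lerXn2r (x_le n); rewrite nnegrE ?mulr_ge0.
    by rewrite exprMn mulrC ler_wpM2l ?sqr_ge0// expr2 ler_piMr.
  have := ler_wpM2l (mulr_ge0 (normr_ge0 T) (normr_ge0 iota)) h.
  by rewrite mulrA; congr (_ <= _); ring.
have a10 : a 1%N <= a 0%N.
  rewrite leNgt; apply/negP => a01.
  have a_incr n : a n < a n.+1.
    elim: n => // n IH; rewrite ltNge; apply/negP => aS.
    have an1 : 0 < a n.+1 by exact: le_lt_trans IH.
    have := a_convex n; rewrite leNgt => /negP; apply.
    rewrite expr2 (@le_lt_trans _ _ (a n * a n.+1))//; first by rewrite ler_wpM2l.
    by rewrite ltr_pM2r.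
  have a_ge n : a 1%N <= a n.+1.
    by elim: n => // n IH; rewrite (le_trans IH)// ltW.
  suff : a 1%N <= 0 by rewrite leNgt (le_lt_trans _ a01).
  apply: (@ler_all_expV2 _ _ (`|T| * `|iota| * `|u| ^+ 2 * 2^-1)) => n.
  by rewrite -[leRHS]mulrA -exprS (le_trans (a_ge n)).
have -> : dot ((T + B) u) (iota u) = a 0%N + dot (T (x 1%N)) (iota (x 0%N)).
  by rewrite xS -dotDl.
have := semidefinite_CauchySchwarz sT T0 (x 1%N) (x 0%N).
rewrite -/(a 1%N) -/(a 0%N) => h.
have {}h : dot (T (x 1%N)) (iota (x 0%N)) ^+ 2 <= a 0%N ^+ 2.
  by rewrite (le_trans h)// expr2 ler_wpM2r.
have : `|dot (T (x 1%N)) (iota (x 0%N))| <= a 0%N.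
  by rewrite -ler_sqr ?nnegrE// real_normK ?num_real.
by rewrite ler_norml => /andP[+ _]; lra.
Qed.

End semidefinite_operators.

(** * First-order expansion and continuity of differentiable families *)

Lemma derivable_near (R : realType) (V : normedModType R) (f : R -> V) (x e : R) :
  derivable f x 1 -> 0 < e ->
  \forall y \near x, `|f y - f x - (y - x) *: derive1 f x| <= e * `|y - x|.
Proof.
move=> df e0; have /cvgrPdist_le /(_ e e0) := df.
rewrite -/(derive f x 1) -derive1E => /nbhs_normP[d /= d0 fd].
apply/nbhs_normP; exists d => // y /= xy.
have [->|yx] := eqVneq y x; first by rewrite !subrr scale0r subrr !normr0 mulr0.
have h0 : y - x != 0 by rewrite subr_eq0.
have := fd (y - x); rewrite /= sub0r normrN distrC => /(_ xy h0).
rewrite scaler1 subrK => fe.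
have -> : f y - f x - (y - x) *: derive1 f x =
    (y - x) *: ((y - x)^-1 *: (f y - f x) - derive1 f x).
  by rewrite scalerBr scalerA mulfV// scale1r.
by rewrite normrZ [leRHS]mulrC (distrC x) ler_wpM2l// distrC.
Qed.

Lemma C1_continuous (R : realType) (V : normedModType R) (f : R -> V) :
  C1 f -> continuous f.
Proof. by move=> [df _] x; apply/differentiable_continuous/derivable1_diffP. Qed.

(** * Families of operators: a parameter with nontrivial kernel, and bordering *)

Section operator_families.
Variables (R : realType) (H : completeNormedModType R) (dot : {dot H for idfun}).
Hypothesis dot_norm : forall u : H, `|u| ^+ 2 = dot u u.
Variables (D : completeNormedModType R) (iota : bounded_op D H).
Implicit Types (T : bounded_op D H) (L A : R -> bounded_op D H).

(** With a trivial kernel, the orthogonal decomposition leaves only a component in the closure of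
    the range, which is the range. *)
Lemma closed_range_self_adjoint_bijective T : self_adjoint dot iota T ->
  closed (range T) -> (forall u, T u = 0 -> u = 0) ->
  injective T /\ forall y, exists u, T u = y.
Proof.
move=> saT clT kerT; split.
  move=> u v Tuv; apply/eqP; rewrite -subr_eq0; apply/eqP/kerT.
  by rewrite bounded_op_morphB Tuv subrr.
move=> y; have [p [z [cp /kerT -> ->]]] :=
  range_orthogonal_decomposition dot_norm y saT.
have [u _ <-] : range T p by exact: clT.
by exists u; rewrite linear0 addr0.
Qed.

Lemma essential_spectrum_closed_range T :
  ~ essential_spectrum iota T 0 -> closed (range T).
Proof. by move=> /contrapT[_]; rewrite scale0r subr0. Qed.

Lemma near_form_lt0 L x u : {for x, continuous L} ->
  dot (L x u) (iota u) < 0 -> \forall k \near x, dot (L k u) (iota u) < 0.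
Proof.
move=> cL qx.
have m0 : 0 < `|u| * `|iota u| + 1 by rewrite ltr_wpDl ?mulr_ge0.
have e0 : 0 < - dot (L x u) (iota u) / (`|u| * `|iota u| + 1).
  by rewrite divr_gt0// oppr_gt0.
have /cvgr_dist_lt /(_ _ e0) := cL.
apply: filterS => k; rewrite ltr_pdivlMr// distrC => h.
have := le_trans (ler_norm _) (ler_dot_norm dot_norm ((L k - L x) u) (iota u)).
rewrite bounded_opB dotBl -bounded_opB.
have := ler_wpM2r (normr_ge0 (iota u)) (ler_op_norm (L k - L x) u).
have := normr_ge0 (L k - L x); move: h; lra.
Qed.

Lemma exists_degenerate_parameter L K :
  continuous L -> (forall k, self_adjoint dot iota (L k)) ->
  (forall k, 0 < k -> closed (range (L k))) ->
  (forall k u, K <= k -> 0 <= dot (L k u) (iota u)) ->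
  (exists u, dot (L 0 u) (iota u) < 0) ->
  exists k, 0 < k /\ exists2 u, u != 0 & L k u = 0.
Proof.
move=> cL saL clL LK L0.
pose E : set R := [set k | 0 <= k /\ exists u, dot (L k u) (iota u) < 0].
have E0 : E 0 by split.
have ubE : ubound E K.
  move=> k [_ [u]]; rewrite ltNge => qk; rewrite leNgt; apply: contra qk.
  by move=> /ltW; exact: LK.
have hE : has_sup E by split; [exists 0|exists K].
pose k0 := sup E.
(* Negativity persists slightly to the right: at 0 this gives [k0 > 0], and at [k0] it would
   contradict the supremum. *)
have open_neg x : (exists u, dot (L x u) (iota u) < 0) ->
    exists2 d, 0 < d & exists u, dot (L (x + d) u) (iota u) < 0.
  move=> [u qx]; have /nbhs_normP[d /= d0 xd] := near_form_lt0 (cL x) qx.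
  exists (d / 2); first by rewrite divr_gt0.
  exists u; apply: xd; rewrite /= opprD addrA subrr sub0r normrN gtr0_norm ?divr_gt0//.
  by rewrite ltr_pdivrMr// ltr_pMr// ltr1n.
have k0_gt0 : 0 < k0.
  have [d d0 q] := open_neg 0 L0.
  rewrite (lt_le_trans d0)//; apply: sup_upper_bound => //.
  by split; [exact: ltW|rewrite add0r in q].
have Lk0 u : 0 <= dot (L k0 u) (iota u).
  rewrite leNgt; apply/negP => q.
  have [d d0 qd] := open_neg k0 (ex_intro _ u q).
  have : k0 + d <= k0.
    by apply: sup_upper_bound => //; split => //; rewrite addr_ge0 ?ltW.
  by rewrite gerDl leNgt d0.
exists k0; split => //; apply: contrapT => ker0.
have [|injL surL] := closed_range_self_adjoint_bijective (saL k0) (clL _ k0_gt0).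
  by move=> u Lu; apply: contrapT => /eqP u0; apply: ker0; exists u.
have [C C0 CL] := bounded_inverse injL surL.
(* Within this distance of [L k0] the form stays nonnegative by [perturbed_semidefinite], yet [E]
   has elements [k] arbitrarily close to [k0]. *)
have e0 : 0 < 2^-1 / C by rewrite divr_gt0// invr_gt0.
have /cvgr_dist_lt /(_ _ e0) /nbhs_normP[d /= d0 Ld] := cL k0.
have [k Ek kd] := sup_adherent d0 hE; have [_ [u]] := Ek.
rewrite ltNge => /negP; apply.
rewrite -[L k](subrK (L k0)) addrC.
apply: (perturbed_semidefinite dot_norm _ _ Lk0 CL surL (ltW C0)).
- exact: self_adjoint_symmetric.
- by apply: symmetric_opB; exact: self_adjoint_symmetric.
- rewrite mulrC -ler_pdivlMr// distrC; apply/ltW/Ld; rewrite /= ger0_norm.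
    by rewrite ltrBlDr -ltrBlDl.
  by rewrite subr_ge0; apply: sup_upper_bound.
Qed.

Lemma near_form_derive L x u v e : derivable L x 1 -> 0 < e ->
  \forall k \near x, `|dot (L k u) v - dot (L x u) v
    - (k - x) * dot (derive1 L x u) v| <= e * `|k - x|.
Proof.
move=> dL e0; have m0 : 0 < `|u| * `|v| + 1 by rewrite ltr_wpDl ?mulr_ge0.
have := derivable_near dL (divr_gt0 e0 m0).
apply: filterS => k; rewrite mulrAC ler_pdivlMr// => h.
rewrite -dotZl -!dotBl -bounded_opZ -!bounded_opB.
rewrite (le_trans (ler_dot_norm dot_norm _ _))// (le_trans _ h)//.
rewrite (le_trans (ler_wpM2r _ (ler_op_norm _ _)))// -mulrA ler_wpM2l//.
by rewrite lerDl.
Qed.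

(** Monotonicity squeezes the form at [u] to 0 on all of [[0, k]], so its left difference quotients
    at [k] cannot tend to a positive derivative. *)
Lemma degenerate_orthogonal_eq0 L k e u : 0 < k -> derivable L k 1 ->
  (forall k1 k2, 0 <= k2 -> k2 <= k1 -> op_ge dot iota (L k1) (L k2)) ->
  (forall u, dot (iota u) (iota e) = 0 -> 0 <= dot (L 0 u) (iota u)) ->
  (u != 0 -> 0 < dot (derive1 L k u) (iota u)) ->
  L k u = 0 -> dot (iota u) (iota e) = 0 -> u = 0.
Proof.
move=> k0 dL mono L0 dLu Lu ue; apply: contrapT => /eqP/dLu b0.
have q0 t : 0 <= t -> t <= k -> dot (L t u) (iota u) = 0.
  move=> t0 tk; apply/eqP; rewrite eq_le (le_trans (L0 u ue) (mono t 0 _ _ u))//.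
  by rewrite andbT (le_trans (mono k t _ _ u))// Lu dot0l.
have b2 : 0 < dot (derive1 L k u) (iota u) / 2 by rewrite divr_gt0.
have /nbhs_normP[d /= d0 kd] := near_form_derive u (iota u) dL b2.
(* The truncation at 0 keeps [t] in [[0, k]], where the form vanishes. *)
pose t := Num.max 0 (k - d / 2).
have t0 : 0 <= t by rewrite le_max lexx.
have tk : t < k by rewrite gt_max k0 gtrBl divr_gt0.
have td : k - d < t.
  by rewrite lt_max; apply/orP; right; rewrite ltrD2l ltrN2 ltr_pdivrMr// ltr_pMr// ltr1n.
have := kd t; rewrite /= distrC ltr0_norm ?subr_lt0//.
rewrite q0 ?(ltW tk)// q0// ?(ltW k0)// subrr sub0r normrN normrM ltr0_norm ?subr_lt0//.
rewrite (gtr0_norm b0) opprB => /(_ _).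
have kt : 0 < k - t by rewrite subr_gt0.
have kd' : k - t < d by lra.
by move=> /(_ kd'); nra.
Qed.

(** For a unit vector [w], the orthogonal projection onto the line of [w], restricted to [D]. *)
Definition rank_one (w : H) (u : D) : H := dot (iota u) w *: w.

Lemma rank_one_linear w : linear (rank_one w).
Proof.
by move=> a u v; rewrite /rank_one linearP dotDl dotZl scalerDl scalerA.
Qed.

Lemma rank_one_subproof w : rank_one w \in @bounded_op_pred R D H.
Proof.
apply/bounded_opP; split; first exact: rank_one_linear.
pose f : {linear D -> H} := HB.pack (rank_one w)
  (GRing.isLinear.Build R D H _ (rank_one w) (rank_one_linear w)).
apply: (@linear_bound_continuous _ _ _ f (`|iota| * `|w| ^+ 2)) => u.
rewrite /= normrZ expr2 mulrA mulrAC ler_wpM2r//.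
rewrite (le_trans (ler_dot_norm dot_norm _ _))//.
by rewrite [leRHS]mulrAC ler_wpM2r// ler_op_norm.
Qed.

Definition rank_one_op w : bounded_op D H := BoundedOp (rank_one_subproof w).

Lemma rank_one_opE w u : rank_one_op w u = dot (iota u) w *: w.
Proof. by []. Qed.

(** The range of [T] is the orthogonal complement of its kernel, the line of [phi]; the rank-one
    term maps this line onto itself and fills the missing direction. *)
Lemma bordered_bijective T phi : self_adjoint dot iota T ->
  closed (range T) -> dot (iota phi) (iota phi) = 1 -> T phi = 0 ->
  (forall u, T u = 0 -> exists a, u = a *: phi) ->
  injective (T + rank_one_op (iota phi)) /\
  forall y, exists u, (T + rank_one_op (iota phi)) u = y.
Proof.
move=> saT clT phi1 Tphi kerT.
have sT := self_adjoint_symmetric saT.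
split.
  move=> u v /eqP; rewrite -subr_eq0 -bounded_op_morphB => /eqP.
  set w := u - v; rewrite bounded_opD rank_one_opE => Tw.
  have w0 : dot (iota w) (iota phi) = 0.
    have := congr1 (fun x => dot x (iota phi)) Tw.
    by rewrite dotDl dotZl sT Tphi dot0r add0r phi1 mulr1 dot0l.
  move: Tw; rewrite w0 scale0r addr0 => /kerT[a wa].
  move: w0; rewrite wa bounded_op_morphZ dotZl phi1 mulr1 => a0.
  by apply/eqP; rewrite -subr_eq0 -/w wa a0 scale0r.
move=> y; have [p [z [cp /kerT[a ->] ->]]] :=
  range_orthogonal_decomposition dot_norm y saT.
have [v _ <-] : range T p by exact: clT.
(* Adding a multiple of [phi] leaves the image under [T] unchanged and adjusts the rank-one
   coefficient to [a]. *)
exists (v + (a - dot (iota v) (iota phi)) *: phi).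
rewrite bounded_opD rank_one_opE !bounded_op_morphD !bounded_op_morphZ.
rewrite Tphi scaler0 addr0 dotDl dotZl phi1 mulr1.
by rewrite [dot _ _ + _]addrC subrK.
Qed.

End operator_families.

(** * Bifurcation from a one-dimensional kernel *)

Section bifurcation.
Variables (R : realType) (H : completeNormedModType R) (dot : {dot H for idfun}).
Hypothesis dot_norm : forall u : H, `|u| ^+ 2 = dot u u.
Variables (D : completeNormedModType R) (iota : bounded_op D H).
Implicit Types (T : bounded_op D H) (L A : R -> bounded_op D H).

(* [M s k u = (L k - s A k) u + (u, phi) phi] is invertible near [(0, k0)].  The
   solution [v s k] of [M s k v = phi] solves the problem when
   [g s k = 1 - (v s k, phi)] vanishes; [g 0] changes sign at [k0], and so does
   [g s] nearby for small [s]. *)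
Lemma simple_kernel_bifurcation L A k0 phi r : 0 < r ->
  continuous L -> continuous A -> derivable L k0 1 ->
  (forall k, self_adjoint dot iota (L k)) -> closed (range (L k0)) ->
  dot (iota phi) (iota phi) = 1 -> L k0 phi = 0 ->
  (forall u, L k0 u = 0 -> exists a, u = a *: phi) ->
  0 < dot (derive1 L k0 phi) (iota phi) ->
  exists s k u, [/\ 0 < s, `|k - k0| < r, u != 0 & s *: A k u = L k u].
Proof.
move=> r0 cL cA dL saL clL phi1 Lphi kerL.
set b := dot _ (iota phi) => b0.
have sL k : symmetric_op dot iota (L k) by exact: self_adjoint_symmetric.
have nphi : `|iota phi| = 1.
  by apply/eqP; rewrite -sqrp_eq1// dot_norm phi1.
have [injN surN] := bordered_bijective dot_norm (saL k0) clL phi1 Lphi kerL.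
set P := rank_one_op dot_norm iota (iota phi) in injN surN.
have [C C0 CN] := bounded_inverse injN surN.
pose M s k := L k - s *: A k + P.
pose region s k := C * `|M s k - (L k0 + P)| <= 2^-1.
have solve s k : region s k ->
    (forall y, exists u, M s k u = y) /\ forall u, `|u| <= C * 2 * `|M s k u|.
  exact: perturbed_solvable.
(* Nothing is asked of [U] outside the region where [M] is known to be invertible. *)
have /choice[U UP] : forall p : R * R, exists u,
    region p.1 p.2 -> M p.1 p.2 u = iota phi.
  move=> [s k]; have [reg|nreg] := pselect (region s k); last by exists 0.
  by have [/(_ (iota phi))[u Mu] _] := solve s k reg; exists u.
pose v s k := U (s, k).
have MU s k : region s k -> M s k (v s k) = iota phi by exact: (UP (s, k)).
pose g s k := 1 - dot (iota (v s k)) (iota phi).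
have Lg s k : region s k -> L k (v s k) - s *: A k (v s k) = g s k *: iota phi.
  move=> /MU; rewrite /M bounded_opD bounded_opB bounded_opZ rank_one_opE => Mv.
  by rewrite scalerBl scale1r -{1}Mv addrK.
have g_lip s k s' k' : region s k -> region s' k' ->
    `|g s k - g s' k'| <= `|iota| * (C * 2) ^+ 2 * `|M s k - M s' k'|.
  move=> reg reg'.
  have v'C : `|v s' k'| <= C * 2.
    by rewrite (le_trans ((solve _ _ reg').2 _))// MU// nphi mulr1.
  (* Resolvent identity: [M s k] maps the difference of the two solutions to
     [(M s' k' - M s k) (v s' k')]. *)
  have vv : `|v s k - v s' k'| <= (C * 2) ^+ 2 * `|M s k - M s' k'|.
    rewrite (le_trans ((solve _ _ reg).2 _))// bounded_op_morphB MU//.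
    rewrite -(MU _ _ reg') -bounded_opB expr2 -[leRHS]mulrA.
    rewrite ler_wpM2l ?mulr_ge0 ?(ltW C0)//.
    by rewrite (le_trans (ler_op_norm _ _))// distrC mulrC ler_wpM2r.
  rewrite /g opprB addrC addrA subrK -dotBl.
  rewrite -bounded_op_morphB (le_trans (ler_dot_norm dot_norm _ _))// nphi mulr1.
  by rewrite (le_trans (ler_op_norm _ _))// -mulrA ler_wpM2l// distrC.
(* [g 0 k = dot (iota (v 0 k)) (L k phi)], the pairing of [Lg] with [phi]. *)
have gE k : region 0 k -> `|g 0 k - (k - k0) * b| <=
    `|dot (L k phi) (iota phi) - dot (L k0 phi) (iota phi) - (k - k0) * b|
    + `|iota| * (C * 2) * `|L k phi| ^+ 2.
  move=> reg.
  have gk : g 0 k = dot (iota (v 0 k)) (L k phi).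
    by rewrite -sL -[L k _](subr0) -[X in _ - X](scale0r (A k (v 0 k))) Lg//
      dotZl phi1 mulr1.
  (* [M 0 k] maps [phi] to [L k phi + iota phi], hence maps [v 0 k - phi] to [- L k phi]. *)
  have vphi : `|v 0 k - phi| <= C * 2 * `|L k phi|.
    rewrite (le_trans ((solve _ _ reg).2 _))// bounded_op_morphB MU//.
    rewrite /M bounded_opD bounded_opB rank_one_opE phi1 scale1r.
    by rewrite bounded_opZ scale0r subr0 opprD addrCA subrr addr0 normrN.
  rewrite Lphi dot0l subr0 gk.
  rewrite -[v 0 k](subrK phi) bounded_op_morphD dotDl (dotC _ (iota phi)) -addrA addrC.
  rewrite (le_trans (ler_normD _ _))// lerD2l.
  rewrite (le_trans (ler_dot_norm dot_norm _ _))// expr2 mulrA ler_wpM2r//.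
  by rewrite -mulrA (le_trans (ler_op_norm _ _))// ler_wpM2l.
pose La := (`|derive1 L k0| + 1) * `|phi|.
have La0 : 0 <= La by rewrite mulr_ge0 ?addr_ge0.
have Lk_le : \forall k \near k0, `|L k phi| <= La * `|k - k0|.
  have := derivable_near dL ltr01; apply: filterS => k; rewrite mul1r => h.
  rewrite -[L k phi]subr0 -Lphi -bounded_opB (le_trans (ler_op_norm _ _))//.
  rewrite /La mulrAC ler_wpM2r// mulrDl mul1r (mulrC `|derive1 L k0|) -normrZ.
  by rewrite -lerBlDl (le_trans (lerB_dist _ _)).
have b4 : 0 < b / 4 by rewrite divr_gt0.
have q0 : 0 < `|iota| * (C * 2) * La ^+ 2 + 1.
  by rewrite ltr_wpDl// !mulr_ge0 ?sqr_ge0 ?(ltW C0).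
have e0 : 0 < 4^-1 / C by rewrite divr_gt0// invr_gt0.
have /cvgr_distC_lt /(_ _ e0) Lnear := cL k0.
have /cvgr_distC_lt /(_ _ ltr01) Anear := cA k0.
(* The variation of [L] takes [4^-1] of the threshold [2^-1] of [region] and leaves the rest to
   [s *: A k]; each of the two errors in [gE] gets slope [b / 4]. *)
have [d d0 dP] : exists2 d, 0 < d & forall k, `|k - k0| < d ->
    [/\ `|k - k0| < r, C * `|L k - L k0| <= 4^-1, `|A k| <= `|A k0| + 1,
      `|L k phi| <= La * `|k - k0| /\
      (`|iota| * (C * 2) * La ^+ 2 + 1) * `|k - k0| <= b / 4 &
      `|dot (L k phi) (iota phi) - dot (L k0 phi) (iota phi) - (k - k0) * b|
        <= b / 4 * `|k - k0|].
  suff /nbhs_normP[d /= d0 dP] : \forall k \near k0,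
    [/\ `|k - k0| < r, C * `|L k - L k0| <= 4^-1, `|A k| <= `|A k0| + 1,
      `|L k phi| <= La * `|k - k0| /\
      (`|iota| * (C * 2) * La ^+ 2 + 1) * `|k - k0| <= b / 4 &
      `|dot (L k phi) (iota phi) - dot (L k0 phi) (iota phi) - (k - k0) * b|
        <= b / 4 * `|k - k0|].
    by exists d => // k kd; apply: dP; rewrite /= distrC.
  have near_k0 e : 0 < e -> \forall k \near k0, `|k - k0| < e.
    by move=> e1; apply/nbhs_normP; exists e => // k /=; rewrite distrC.
  near=> k; split.
  - by near: k; exact: near_k0.
  - rewrite mulrC -ler_pdivlMr//; apply/ltW; near: k; exact: Lnear.
  - rewrite -lerBlDl (le_trans (lerB_dist _ _))//; apply/ltW; near: k; exact: Anear.
  - split; first by near: k.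
    rewrite mulrC -ler_pdivlMr//; apply/ltW; near: k.
    by apply: near_k0; rewrite divr_gt0.
  - by near: k; exact: near_form_derive.
pose G := `|iota| * (C * 2) ^+ 2 * (`|A k0| + 1).
have G0 : 0 <= G by rewrite !mulr_ge0 ?addr_ge0 ?(ltW C0).
have F0 : 0 < C * (`|A k0| + 1) * 4 + 1.
  by rewrite ltr_wpDl// !mulr_ge0 ?(ltW C0) ?addr_ge0.
(* The first bound keeps [(s, k)] in [region]; the second makes the shift from [g 0] to [g s]
   smaller than [b * d / 4]. *)
have [s s0 [sC sG]] : exists2 s, 0 < s &
    C * (s * (`|A k0| + 1)) <= 4^-1 /\ s * G < b / 4 * d.
  pose s := Num.min (C * (`|A k0| + 1) * 4 + 1)^-1 (b / 4 * d / (G + 1)).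
  have G1 : 0 < G + 1 by rewrite ltr_wpDl.
  have s0 : 0 < s by rewrite lt_min invr_gt0 F0 divr_gt0// mulr_gt0.
  exists s => //.
  split.
    have : s <= (C * (`|A k0| + 1) * 4 + 1)^-1 by rewrite ge_min lexx.
    rewrite -[leRHS]mul1r ler_pdivlMr// => h.
    by move: h s0; rewrite mulrCA; lra.
  have : s <= b / 4 * d / (G + 1) by rewrite ge_min lexx orbT.
  rewrite ler_pdivlMr// => h.
  by rewrite (lt_le_trans _ h)// ltr_pM2l// ltrDl.
have reg t k : 0 <= t -> t <= s -> `|k - k0| < d -> region t k.
  move=> t0 ts /dP[_ LC AC _ _]; rewrite /region.
  have -> : M t k - (L k0 + P) = (L k - L k0) - t *: A k.
    by rewrite /M opprD addrACA subrr addr0 addrAC.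
  rewrite (le_trans (ler_wpM2l (ltW C0) (ler_normB _ _)))// normrZ (ger0_norm t0).
  have : t * `|A k| <= s * (`|A k0| + 1) by rewrite ler_pM.
  move=> /(ler_wpM2l (ltW C0)); lra.
pose k1 := k0 - d / 2; pose k2 := k0 + d / 2.
have d2 : 0 < d / 2 by rewrite divr_gt0.
have d2d : d / 2 < d by rewrite ltr_pdivrMr// ltr_pMr// ltr1n.
(* At distance [d / 2] the errors in [gE] add up to at most [b * d / 4], and the shift by [s] adds
   less than [b * d / 4], so [g s] has the sign of [k - k0]. *)
have gsign k : `|k - k0| = d / 2 -> `|g s k - (k - k0) * b| < d / 2 * b.
  move=> kd; have kd' : `|k - k0| < d by rewrite kd.
  have [_ _ AC [Lkp small] form] := dP k kd'.
  have g1 := gE k (reg _ _ (lexx 0) (ltW s0) kd').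
  have g2 : `|g s k - g 0 k| <= s * G.
    rewrite (le_trans (g_lip _ _ _ _ (reg _ _ (ltW s0) (lexx s) kd')
      (reg _ _ (lexx 0) (ltW s0) kd')))//.
    rewrite /M scale0r subr0 opprD addrACA subrr addr0 addrAC subrr sub0r.
    rewrite normrN normrZ (gtr0_norm s0).
    have i0 : 0 <= `|iota| * (C * 2) ^+ 2 by rewrite mulr_ge0// sqr_ge0.
    by rewrite /G [leRHS]mulrCA (ler_wpM2l i0)// ler_wpM2l// ltW.
  have Lk2 : `|iota| * (C * 2) * `|L k phi| ^+ 2 <= b / 4 * `|k - k0|.
    have h : `|L k phi| ^+ 2 <= La ^+ 2 * `|k - k0| * `|k - k0|.
      rewrite -mulrA -expr2 -exprMn. apply: lerXn2r Lkp; by rewrite nnegrE ?mulr_ge0.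
    have i0 : 0 <= `|iota| * (C * 2) by rewrite !mulr_ge0 ?(ltW C0).
    rewrite (le_trans (ler_wpM2l i0 h))// 2!mulrA ler_wpM2r//.
    by rewrite (le_trans _ small)// ler_wpM2r// lerDl.
  have -> : g s k - (k - k0) * b = (g s k - g 0 k) + (g 0 k - (k - k0) * b).
    by rewrite addrA subrK.
  rewrite (le_lt_trans (ler_normD _ _))//.
  by move: g1 g2 Lk2 form sG; rewrite kd; lra.
have k1k : k1 - k0 = - (d / 2) by rewrite /k1 addrAC subrr add0r.
have k2k : k2 - k0 = d / 2 by rewrite /k2 addrAC subrr add0r.
have g1 : g s k1 < 0.
  have := gsign k1; rewrite k1k normrN gtr0_norm// => /(_ erefl).
  by rewrite ltr_norml => /andP[_]; lra.
have g2 : 0 < g s k2.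
  have := gsign k2; rewrite k2k gtr0_norm// => /(_ erefl).
  by rewrite ltr_norml => /andP[+ _]; lra.
have k12 : k1 <= k2 by rewrite lerD2l; lra.
have k12d k : k \in `[k1, k2] -> `|k - k0| < d.
  rewrite in_itv/= => /andP[kk1 kk2].
  by rewrite (le_lt_trans _ d2d)// ler_norml; move: kk1 kk2; rewrite /k1 /k2; lra.
have g_cont : {within `[k1, k2], continuous (g s)}.
  apply: continuous_in_subspaceT => k /set_mem/= /k12d kd.
  have regk := reg _ _ (ltW s0) (lexx s) kd.
  pose Z := `|iota| * (C * 2) ^+ 2 + 1.
  have Z0 : 0 < Z by rewrite ltr_wpDl// mulr_ge0 ?sqr_ge0.
  have cM : M s x @[x --> k] --> M s k.
    by apply: cvgD; [apply: cvgB; [exact: cL|apply: cvgZr; exact: cA]|exact: cvg_cst].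
  apply/cvgrPdist_lt => e e1.
  have /cvgr_dist_lt /(_ _ (divr_gt0 e1 Z0)) Mnear := cM.
  near=> x.
  have xd : `|x - k0| < d.
    have -> : x - k0 = (k - k0) - (k - x) by rewrite opprB [RHS]addrC addrA subrK.
    rewrite (le_lt_trans (ler_normB _ _))// -ltrBrDl.
    near: x; apply/nbhs_normP; exists (d - `|k - k0|) => //=.
    by rewrite subr_gt0.
  rewrite (le_lt_trans (g_lip _ _ _ _ regk (reg _ _ (ltW s0) (lexx s) xd)))//.
  rewrite (@le_lt_trans _ _ (Z * `|M s k - M s x|))//.
    by rewrite ler_wpM2r// lerDl.
  by rewrite mulrC -ltr_pdivlMr//; near: x.
have [|k kk gk0] := @IVT R (g s) k1 k2 0 k12 g_cont.
  by rewrite ge_min (ltW g1)/= le_max (ltW g2) orbT.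
have regk := reg _ _ (ltW s0) (lexx s) (k12d _ kk).
exists s, k, (v s k); split => //.
- by have [] := dP k (k12d _ kk).
- apply/eqP => v0; have := MU _ _ regk; rewrite v0 linear0 => /eqP.
  by rewrite eq_sym -normr_eq0 nphi oner_eq0.
- by apply/esym/eqP; rewrite -subr_eq0 Lg// gk0 scale0r.
Unshelve. all: by end_near. Qed.

End bifurcation.

(** * From the spectral assumptions to the bifurcation *)

Theorem theorem1p1 (R : realType)
  (H : completeNormedModType R) (dot : {dot H for idfun})
  (dot_norm : forall u : H, `|u| ^+ 2 = dot u u)
  (D : completeNormedModType R) (iota : bounded_op D H)
  (iota_inj : injective iota)
  (L A : R -> bounded_op D H)
  (L_sa : forall k, self_adjoint dot iota (L k))
  (L_C1 : C1 L) (A_C1 : C1 A)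
  (H1 : exists K alpha : R, [/\ 0 < K, 0 < alpha &
    forall k, K <= `|k| -> op_ge dot iota (L k) (alpha *: iota)])
  (H2 : forall k, k != 0 -> exists2 c : R, 0 < c &
    essential_spectrum iota (L k) `<=` [set x | c <= x])
  (H3 : forall k1 k2, 0 <= k2 -> k2 <= k1 -> op_ge dot iota (L k1) (L k2))
  (H3' : forall k U, 0 < k -> U != 0 -> L k U = 0 ->
    0 < dot (derive1 L k U) (iota U))
  (H4 : exists (lambda : R) (I : set R),
    [/\ spectrum iota (L 0) = [set - lambda] `|` I, - lambda < 0,
        isolated (spectrum iota (L 0)) (- lambda),
        simple_eigenvalue iota (L 0) (- lambda) &
        I `<=` [set x | 0 <= x]]) :
  exists (sigma k : R) (U : D),
    [/\ 0 < sigma, k != 0, U != 0 & sigma *: A k U = L k U].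
Proof.
case: H1 => K [alpha [K0 alpha0 LK]].
case: H4 => lam [I [spec]]; rewrite oppr_lt0 => lam0 _ [e e0 kere] I0.
(* The shift moves the simple eigenvalue to 0 and the rest of the spectrum into [[lam, +oo)]. *)
pose T := L 0 - (- lam) *: iota.
have Te : T e = 0.
  suff : ker T e by [].
  by rewrite [ker T]kere; exists 1 => //; rewrite scale1r.
have L0e : L 0 e = - lam *: iota e.
  by apply/eqP; rewrite -subr_eq0 -bounded_opZ -bounded_opB; apply/eqP.
have iota_gt0 u : u != 0 -> 0 < `|iota u|.
  move=> u0; rewrite normr_gt0; apply: contra u0 => /eqP iu.
  by apply/eqP/iota_inj; rewrite iu linear0.
have L0_resolvent t : t < 0 -> t != - lam -> resolvent_set iota (L 0) t.
  move=> t0 tlam; apply: contrapT => nres.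
  have : spectrum iota (L 0) t by [].
  rewrite spec => -[/= tE|/I0 /=]; first by rewrite tE eqxx in tlam.
  by rewrite leNgt t0.
(* Orthogonally to [e], the coercivity constant [lam] of [T] exactly compensates the shift. *)
have L0_semidefinite u : dot (iota u) (iota e) = 0 -> 0 <= dot (L 0 u) (iota u).
  move=> ue.
  have : lam * `|iota u| ^+ 2 <= dot (T u) (iota u).
    apply: (spectral_gap_coercive dot_norm lam0 (self_adjoint_shift _ (L_sa 0))).
      move=> t tlam t0; apply/resolvent_set_shift/L0_resolvent; first by lra.
      by apply: contra t0 => /eqP h; apply/eqP; lra.
    move=> z Tz; have : ker T z by [].
    rewrite [ker T]kere => -[a _ <-].
    by rewrite bounded_op_morphZ dotZr ue mulr0.
  by rewrite bounded_opB bounded_opZ dotBl dotZl -dot_norm; lra.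
have cL := C1_continuous L_C1.
have closed_L k : 0 < k -> closed (range (L k)).
  move=> k0; apply: essential_spectrum_closed_range.
  have [c c0 ess] := H2 k (lt0r_neq0 k0).
  by move=> /ess /=; rewrite leNgt c0.
have [||k0 [k0_gt0 [psi psi0 Lpsi]]] :=
    @exists_degenerate_parameter _ _ _ dot_norm _ iota L K cL L_sa closed_L.
- move=> k u Kk; have := LK k (le_trans Kk (ler_norm k)) u.
  rewrite bounded_opZ dotZl -dot_norm; apply: le_trans.
  by rewrite mulr_ge0 ?(ltW alpha0) ?sqr_ge0.
- exists e; rewrite L0e dotZl -dot_norm nmulr_rlt0 ?oppr_lt0//.
  by rewrite exprn_gt0// iota_gt0.
have ker_eq0 u : L k0 u = 0 -> dot (iota u) (iota e) = 0 -> u = 0.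
  move=> Lu; apply: (degenerate_orthogonal_eq0 dot_norm k0_gt0 (L_C1.1 k0) H3
    L0_semidefinite) => // u0; exact: H3'.
pose phi := `|iota psi|^-1 *: psi.
have phi0 : phi != 0.
  by rewrite scaler_eq0 negb_or psi0 invr_eq0 gt_eqF ?iota_gt0.
have Lphi : L k0 phi = 0 by rewrite bounded_op_morphZ Lpsi scaler0.
have phi1 : dot (iota phi) (iota phi) = 1.
  rewrite -dot_norm bounded_op_morphZ normrZ normfV normr_id mulVf ?expr1n//.
  by rewrite gt_eqF ?iota_gt0.
have ker_line u : L k0 u = 0 -> exists a, u = a *: phi.
  move=> Lu; pose c := dot (iota phi) (iota e).
  have c0 : c != 0 by apply: contra phi0 => /eqP /(ker_eq0 _ Lphi) ->.
  (* This coefficient makes the difference orthogonal to [e]; being in the kernel, it vanishes by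
     [ker_eq0]. *)
  exists (dot (iota u) (iota e) / c); apply/eqP; rewrite -subr_eq0; apply/eqP.
  apply: ker_eq0; first by
    rewrite bounded_op_morphB bounded_op_morphZ Lu Lphi scaler0 subr0.
  by rewrite bounded_op_morphB bounded_op_morphZ dotBl dotZl divfK// subrr.
(* The radius is taken to be [k0] itself, so that [|k - k0| < k0] excludes [k = 0]. *)
have [s [k [u [s0 kk0 u0 E]]]] := simple_kernel_bifurcation dot_norm k0_gt0 cL
  (C1_continuous A_C1) (L_C1.1 k0) L_sa (closed_L _ k0_gt0) phi1 Lphi ker_line
  (H3' _ _ k0_gt0 phi0 Lphi).
exists s, k, u; split => //.
by apply: contraTneq kk0 => ->; rewrite sub0r normrN gtr0_norm// ltxx.
Qed.
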